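(* The set $B=B(X)$ with the multiplication $\circ$ (defined in the context) is a free Bol loop of exponent $2$ with free set of generators $X$.
   Context: Loops: a (right) Bol loop is a loop satisfying $x((yz)y)=((xy)z)y$. It has exponent two if $xx=1$ for every $x$. A Bol loop $B$ of exponent two is free with free set of generators $X\subset B$ if $X$ generates $B$ and every mapping from $X$ to a Bol loop $B'$ of exponent two extends to a homomorphism $B\to B'$. Words: let $X=\{x_1,\dots,x_r\}$ be a finite ordered set of letters, and let $P=P(X)$ be the set of all non-associative (fully bracketed) words on $X$, including the empty word $1$, with product given by juxtaposition and $1u=u1=u$. $|v|$ is the number of letters of $v$. Products without brackets are left-normed: $v_1v_2\cdots v_n=(\cdots((v_1v_2)v_3)\cdots)v_n$. $Sub(v)$ is the set of nonempty subwords: $Sub(1)=\emptyset$, $Sub(x)=\{x\}$ for $x\in X$, $Sub(v_1v_2)=\{v_1v_2\}\cup Sub(v_1)\cup Sub(v_2)$ for nonempty $v_1,v_2$. Put $C(X)=\{uu,(uv)v\mid u,v\in P\setminus\{1\}\}$ and $W=W(X)=\{v\in P\mid Sub(v)\cap C(X)=\emptyset\}$ (so $1\in W$). The map $\pi:P\to W$ is defined by induction on length: $\pi(1)=1$; $\pi(x)=x$ for $x\in X$; if $u,v\in W$, then $\pi(uv)=1$ if $u=v$, $\pi(uv)=a$ if $u=av$, and $\pi(uv)=uv$ if $uv\in W$; if $u\notin W$ or $v\notin W$, then $\pi(uv)=\pi(\pi(u)\pi(v))$. The sets $R(X)$ and $B(X)$: each nonempty $y\in P$ has a unique decomposition $y=y_1y_2\cdots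 y_{m-1}y'_m$ (left-normed, nonempty factors) whose first factor is a letter; put $y^t=y'_my_{m-1}\cdots y_1$ and $y^{tt}=(y^t)^t$. Words are ordered by: $x_i>x_j$ if $i>j$; $u>v$ if $|u|>|v|$; if $|u|=|v|\ge 2$, $u=u_1u_2$, $v=v_1v_2$ (nonempty factors), then $u>v$ if $u_2>v_2$, or if $u_2=v_2$ and $u_1>v_1$. For $y\in W\setminus\{1\}$ let $y_0=\min\{y^t,y^{tt}\}$, and let $D=\{y_0\mid y,y_0,y_0^t\in W,\ y_0^t\neq y_0\}$. Put $R_1=X$, $R_n=R_{n-1}\cup\{y\in D\mid |y|\le n,\ y=u_1u_2\cdots u_m \text{ for some } u_1,\dots,u_m\in R_{n-1}\}$ for $n>1$, and $R(X)=\bigcup_n R_n$. Put $B(X)=\{1\}\cup\{y\in W\mid y=y_1y_2\cdots y_n,\ y_i\in R(X)\}$. Multiplication: for every $g\in B(X)\setminus\{1\}$ there are unique $g_1,\dots,g_m\in R(X)$ with $g_i\ne g_{i+1}$ for $i=1,\dots,m-1$ and $g=\pi(g_1g_2\cdots g_mg_{m-1}\cdots g_1)$; put $s(g)=g_1g_2\cdots g_mg_{m-1}\cdots g_1$. Define $\circ$ on $B(X)$ by $x\circ1=1\circ x=x$, and, for $y\neq1$ with $s(y)=y_1y_2\cdots y_my_{m-1}\cdots y_1$, $x\circ y=\pi(xy_1y_2\cdots y_my_{m-1}\cdots y_1)$. *)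

(* Defs.v *)
From HB Require Import structures.
From mathcomp Require Import all_boot.
From mathcomp Require Import boolp classical_sets.

Set Implicit Arguments.
Unset Strict Implicit.
Unset Printing Implicit Defensive.

Local Open Scope classical_set_scope.

Definition is_loop (L : Type) (mul : L -> L -> L) (e : L) : Prop :=
  [/\ left_id e mul, right_id e mul,
      forall a b, exists! x, mul a x = b
    & forall a b, exists! y, mul y a = b].

Definition right_bol (L : Type) (mul : L -> L -> L) : Prop :=
  forall x y z, mul x (mul (mul y z) y) = mul (mul (mul x y) z) y.

Definition is_bol_loop2 (L : Type) (mul : L -> L -> L) (e : L) : Prop :=
  [/\ is_loop mul e, right_bol mul & forall x, mul x x = e].

(* A subloop contains the unit and is closed under the product and under both
   divisions. *)
Definition is_subloop (L : Type) (mul : L -> L -> L) (e : L) (S : set L) :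
    Prop :=
  [/\ S e,
      forall a b, S a -> S b -> S (mul a b),
      forall a x, S a -> S (mul a x) -> S x
    & forall a y, S a -> S (mul y a) -> S y].

Definition generates (L : Type) (mul : L -> L -> L) (e : L) (X : set L) :
    Prop :=
  forall S : set L, is_subloop mul e S -> X `<=` S -> S = setT.

(* The free set of generators is the image of an injective family
   [gen : I -> L]; a mapping from it to L' is then a function I -> L'. *)
Definition free_bol_loop2 (L : Type) (mul : L -> L -> L) (e : L)
    (I : Type) (gen : I -> L) : Prop :=
  [/\ is_bol_loop2 mul e,
      injective gen,
      generates mul e (range gen)
    & forall (L' : Type) (mul' : L' -> L' -> L') (e' : L'),
        is_bol_loop2 mul' e' -> forall f : I -> L',
        exists h : L -> L',
          {morph h : x y / mul x y >-> mul' x y} /\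
          (forall i, h (gen i) = f i)].

Inductive nword (r : nat) : Type :=
  | Letter of 'I_r
  | Node of nword r & nword r.

(* All words: [None] is the empty word, and the letters are ordered as 'I_r. *)
Notation word r := (option (nword r)).

Section NwordChoice.
Variable r : nat.

Fixpoint nword_enc (t : nword r) : GenTree.tree 'I_r :=
  match t with
  | Letter i => GenTree.Leaf i
  | Node u v => GenTree.Node 0 [:: nword_enc u; nword_enc v]
  end.

Fixpoint nword_dec (t : GenTree.tree 'I_r) : option (nword r) :=
  match t with
  | GenTree.Leaf i => Some (Letter i)
  | GenTree.Node _ [:: a; b] =>
      if (nword_dec a, nword_dec b) is (Some u, Some v)
      then Some (Node u v) else None
  | _ => None
  end.

Lemma nword_encK : pcancel nword_enc nword_dec.
Proof. by elim=> //= u -> v ->. Qed.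

HB.instance Definition _ := Countable.copy (nword r) (pcan_type nword_encK).

End NwordChoice.

Section Words.
Variable r : nat.
Implicit Types (a b t u v y z : nword r) (w x : word r).

Definition wmul (w1 w2 : word r) : word r :=
  match w1, w2 with
  | None, _ => w2
  | _, None => w1
  | Some u, Some v => Some (Node u v)
  end.

(* The left-normed product x y_1 ... y_n; for x = None it is y_1 ... y_n. *)
Definition lnprod (x : word r) (ys : seq (nword r)) : word r :=
  foldl (fun w y => wmul w (Some y)) x ys.

Fixpoint len (t : nword r) : nat :=
  match t with
  | Letter _ => 1
  | Node u v => len u + len v
  end.

Fixpoint nsub (t : nword r) : set (nword r) :=
  match t with
  | Letter _ => [set t]
  | Node u v => [set t] `|` nsub u `|` nsub v
  end.

Definition Sub (w : word r) : set (nword r) :=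
  if w is Some t then nsub t else set0.

Definition C : set (nword r) :=
  [set t | (exists u, t = Node u u) \/ (exists u v, t = Node (Node u v) v)].

Definition W : set (word r) := [set w | Sub w `&` C = set0].

(* The value of pi (w1 w2) for w1 and w2 in W. *)
Definition reduce (w1 w2 : word r) : word r :=
  if w1 == w2 then None else
  match w1, w2 with
  | Some (Node a b), Some v => if b == v then Some a else wmul w1 w2
  | _, _ => wmul w1 w2
  end.

Fixpoint npi (t : nword r) : word r :=
  match t with
  | Letter _ => Some t
  | Node u v => reduce (npi u) (npi v)
  end.

(* pi is defined here by structural recursion; the lemmas pi_W, pi_square,
   pi_cancel, pi_id and pi_wmul below give its recursion on the length. *)
Definition pi (w : word r) : word r := if w is Some t then npi t else None.

(* The factors y_1, ..., y_m of the decomposition t = y_1 ... y_m in which y_1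
   is a letter. *)
Fixpoint factors (t : nword r) : seq (nword r) :=
  match t with
  | Letter _ => [:: t]
  | Node u v => rcons (factors u) v
  end.

(* y_m y_(m-1) ... y_1 *)
Definition tr (t : nword r) : nword r :=
  match t with
  | Letter _ => t
  | Node u v => foldl (@Node r) v (rev (factors u))
  end.

Fixpoint wlt (u v : nword r) : bool :=
  (len u < len v) ||
  (len u == len v) &&
  match u, v with
  | Letter i, Letter j => i < j
  | Node u1 u2, Node v1 v2 => wlt u2 v2 || (u2 == v2) && wlt u1 v1
  | _, _ => false
  end.

Definition wmin (u v : nword r) : nword r := if wlt u v then u else v.

Definition y0 (y : nword r) : nword r := wmin (tr y) (tr (tr y)).

Definition D : set (nword r) :=
  [set y0 y | y in [set y | [/\ W (Some y), W (Some (y0 y)),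
                                W (Some (tr (y0 y))) & tr (y0 y) <> y0 y]]].

(* [Rn n] is R_n for n >= 1. *)
Fixpoint Rn (n : nat) : set (nword r) :=
  match n with
  | 0 => set0
  | n'.+1 =>
    match n' with
    | 0 => range (@Letter r)
    | _ => Rn n' `|`
           [set y | [/\ D y, len y <= n
                      & exists us, {in us, forall u, Rn n' u} /\
                                   Some y = lnprod None us]]
    end
  end.

Definition R : set (nword r) := \bigcup_n Rn n.

Definition B : set (word r) :=
  [set None] `|`
  [set w | W w /\ exists ys, {in ys, forall y, R y} /\ w = lnprod None ys].

(* g_1 ... g_m g_(m-1) ... g_1 *)
Definition palindrome (gs : seq (nword r)) : seq (nword r) :=
  gs ++ behead (rev gs).

Definition is_pal_fact (g : word r) (gs : seq (nword r)) : Prop :=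
  [/\ {in gs, forall y, R y}, sorted (fun u v => u != v) gs
    & g = pi (lnprod None (palindrome gs))].

(* Meaningful only when g <> None, where the sequence g_1, ..., g_m exists and
   is unique. *)
Definition pal_fact (g : word r) : seq (nword r) :=
  xget [::] [set gs | is_pal_fact g gs].

Definition circ (x y : word r) : word r :=
  if y == None then x else if x == None then y
  else pi (lnprod x (palindrome (pal_fact y))).

Lemma W_None : W None.
Proof. by rewrite /W /= set0I. Qed.

Lemma W_Letter i : W (Some (Letter i)).
Proof.
rewrite /W /=; apply/seteqP; split=> // t [/= ->].
by case=> [[u]|[u [v]]].
Qed.

Lemma W_Node u v :
  W (Some (Node u v)) <->
  [/\ W (Some u), W (Some v), u <> v & forall a, u <> Node a v].
Proof.
rewrite /W /=; split=> [H|[Hu Hv nuv nua]].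
- have N t : nsub (Node u v) t -> ~ C t.
    by move=> St Ct; have : set0 t by rewrite -H.
  split.
  + by apply/seteqP; split=> // t [St]; apply: N => /=; left; right.
  + by apply/seteqP; split=> // t [St]; apply: N => /=; right.
  + by move=> euv; apply: (N (Node u v)); [left; left|left; exists u; rewrite euv].
  + move=> a eu; apply: (N (Node u v)); first by left; left.
    by right; exists a, v; rewrite eu.
- apply/seteqP; split=> // t [[[->|Su]|Sv] Ct].
  + case: Ct => [[a [eu ev]]|[a [b [eu ev]]]].
      by apply: nuv; rewrite eu ev.
    by apply: (nua a); rewrite eu ev.
  + by rewrite -Hu.
  + by rewrite -Hv.
Qed.

Lemma reduce_W w1 w2 : W w1 -> W w2 -> W (reduce w1 w2).
Proof.
rewrite /reduce; case: eqVneq => [_ _ _|ne]; first exact: W_None.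
case: w1 w2 ne => [[i|a b]|] [v|] //= ne W1 W2.
- by apply/W_Node; split=> // e; move: ne; rewrite e eqxx.
- case: eqVneq => [_|nb]; first by case/W_Node: W1.
  apply/W_Node; split=> //; first by move=> e; move: ne; rewrite e eqxx.
  by move=> c [_ e]; move: nb; rewrite e eqxx.
Qed.

Lemma reduce_wmul w1 w2 : W (wmul w1 w2) -> reduce w1 w2 = wmul w1 w2.
Proof.
rewrite /reduce; case: eqVneq => [->|ne].
  by case: w2 => [v|] // /W_Node[_ _ /(_ erefl)].
case: w1 w2 ne => [[i|a b]|] [v|] //= ne.
by case: eqVneq => // -> /W_Node[_ _ _ /(_ a)].
Qed.

Lemma pi_W w : W (pi w).
Proof.
case: w => [t|] /=; last exact: W_None.
by elim: t => [i|u IHu v IHv] /=; [exact: W_Letter|exact: reduce_W].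
Qed.

Lemma pi_id w : W w -> pi w = w.
Proof.
case: w => [t|] //=; elim: t => [i|u IHu v IHv] //= Wuv.
have /W_Node[Wu Wv _ _] := Wuv.
by rewrite IHu // IHv // reduce_wmul.
Qed.

Lemma pi_reduce w1 w2 : pi (wmul w1 w2) = reduce (pi w1) (pi w2).
Proof.
case: w1 w2 => [u|] [v|] //=; last by case: (npi v).
by case: (npi u) => [[]|].
Qed.

Lemma pi_square w : W w -> pi (wmul w w) = None.
Proof. by move=> Ww; rewrite pi_reduce pi_id // /reduce eqxx. Qed.

Lemma pi_cancel w1 w2 : W (wmul w1 w2) -> W w2 ->
  pi (wmul (wmul w1 w2) w2) = w1.
Proof.
move=> W12 W2; rewrite pi_reduce !pi_id // /reduce.
case: w1 w2 {W12 W2} => [u|] [v|] //=; last by rewrite eqxx.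
- rewrite eqxx; case: eqP => // -[] /(congr1 len) /= /eqP.
  have lu : 0 < len u by elim: (u) => //= a la b _; rewrite addn_gt0 la.
  by rewrite -[X in _ == X]add0n eqn_add2r eqn0Ngt lu.
- by case: u.
Qed.

Lemma pi_wmul w1 w2 : pi (wmul w1 w2) = pi (wmul (pi w1) (pi w2)).
Proof. by rewrite !pi_reduce !(pi_id (pi_W _)). Qed.

Lemma factorsP t i us :
  factors t = Letter i :: us <-> Some t = lnprod None (Letter i :: us).
Proof.
have lnS u vs : lnprod (Some u) vs = Some (foldl (@Node r) u vs).
  by elim: vs u => //= v vs IH u; rewrite IH.
have f0 a : factors a <> [::] by case: a => //= a b; case: (factors a).
have -> : lnprod None (Letter i :: us) = Some (foldl (@Node r) (Letter i) us).
  exact: lnS.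
elim/last_ind: us t => [|us u IH] [j|a b]; split=> //=.
- by case=> ->.
- by case=> ->.
- by case: (factors a) (f0 a) => // c [].
- by case=> _; case: us {IH}.
- by rewrite foldl_rcons.
- by rewrite -rcons_cons => /rcons_inj[/IH[->] ->]; rewrite foldl_rcons.
- by rewrite foldl_rcons => -[ea ->]; rewrite -rcons_cons (IH a).2 // ea.
Qed.

Lemma R_W y : R y -> W (Some y).
Proof.
case=> n _; elim: n => //= -[_ [i _ <-]|n IH [/IH//|[[z [_ Wz _ _] <-] _ _]]].
  exact: W_Letter.
exact: Wz.
Qed.

Lemma B_W w : B w -> W w.
Proof. by case=> [->|[]//]; exact: W_None. Qed.

Lemma lnprod_rcons x ys y : lnprod x (rcons ys y) = wmul (lnprod x ys) (Some y).
Proof. by rewrite /lnprod foldl_rcons. Qed.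

Lemma R_left a b : R (Node a b) ->
  exists us, {in us, forall u, R u} /\ Some a = lnprod None us.
Proof.
case=> n _; elim: n => //= -[_ [i _]//|n IH [/IH//|[_ _ [us [Rus]]]]].
have {}Rus : {in us, forall u, Rn n.+1 u} by [].
case/lastP: us Rus => // us u Rus; rewrite lnprod_rcons.
have Ru : Rn n.+1 u by apply: Rus; rewrite mem_rcons mem_head.
case E: (lnprod None us) => [t|] /= [].
- move=> -> _; exists us; split=> // v vus.
  by exists n.+1 => //; apply: Rus; rewrite mem_rcons inE vus orbT.
- by move=> e; apply: IH; rewrite e.
Qed.

Lemma B_left a b : B (Some (Node a b)) -> B (Some a).
Proof.
case=> // -[/W_Node[Wa _ _ _] [ys [Rys H]]]; right; split=> //.
case/lastP: ys Rys H => // ys y Rys; rewrite lnprod_rcons.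
have Ry : R y by apply: Rys; rewrite mem_rcons mem_head.
case E: (lnprod None ys) => [t|] /= [].
- move=> -> _; exists ys; split=> // v vys.
  by apply: Rys; rewrite mem_rcons inE vys orbT.
- by move=> e; apply: (@R_left a b); rewrite e.
Qed.

Lemma B_reduce w y : B w -> R y -> B (reduce w (Some y)).
Proof.
move=> Bw Ry; have Wr := reduce_W (B_W Bw) (R_W Ry).
have Bm : reduce w (Some y) = wmul w (Some y) -> B (reduce w (Some y)).
  move=> e; right; split=> //; rewrite e.
  case: Bw => [->|[_ [ys [Rys ->]]]].
    by exists [:: y]; split=> // v; rewrite inE => /eqP->.
  exists (rcons ys y); split; last by rewrite lnprod_rcons.
  by move=> v; rewrite mem_rcons inE => /predU1P[->|/Rys].
move: Bm; rewrite /reduce; case: eqVneq => [_ _|_]; first by left.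
case: w Bw {Wr} => [[i|a b]|] Bw; try exact.
by case: eqVneq => [_ _|_]; [exact: B_left Bw|exact].
Qed.

Lemma B_pi_lnprod x ys :
  B x -> {in ys, forall y, R y} -> B (pi (lnprod x ys)).
Proof.
move=> Bx; elim/last_ind: ys => [_|ys y IH Rys].
  by rewrite pi_id //; exact: B_W.
have Ry : R y by apply: Rys; rewrite mem_rcons mem_head.
rewrite lnprod_rcons pi_reduce (pi_id (R_W Ry)).
apply: B_reduce => //; apply: IH => v vys.
by apply: Rys; rewrite mem_rcons inE vys orbT.
Qed.

Lemma B_circ (x y : word r) : B x -> B y -> B (circ x y).
Proof.
move=> Bx By; rewrite /circ; case: eqP => // _; case: eqP => // _.
apply: B_pi_lnprod => // v; rewrite /palindrome mem_cat /pal_fact.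
case: xgetP => // gs _ [Rgs _ _] /orP[/Rgs//|/mem_behead].
by rewrite mem_rev; exact: Rgs.
Qed.

Lemma B_None : B None.
Proof. by left. Qed.

Lemma B_Letter i : B (Some (Letter i)).
Proof.
right; split; first exact: W_Letter.
exists [:: Letter i]; split=> // v; rewrite inE => /eqP->.
by exists 1 => //; exists i.
Qed.

Definition BX : Type := set_type B.

Definition BXmul (x y : BX) : BX :=
  exist _ (circ (val x) (val y))
        (mem_set (B_circ (set_mem (valP x)) (set_mem (valP y)))).

Definition BXone : BX := exist _ None (mem_set B_None).

Definition BXgen (i : 'I_r) : BX :=
  exist _ (Some (Letter i)) (mem_set (B_Letter i)).

End Words.

Arguments BXmul {r}.
Arguments BXone {r}.
Arguments BXgen {r}.

(* Main.v *)
Require Import Defs.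
From mathcomp Require Import all_boot boolp classical_sets.
From mathcomp Require Import zify.

Set Implicit Arguments.
Unset Strict Implicit.
Unset Printing Implicit Defensive.

(** The free product [G] of groups of order two indexed by [R] acts on the
right on reduced words, [y] in [R] acting by [w |-> pi (w y)].  The involutions
of [G] are given by the reduced odd palindromes, and the first claim is that
evaluation at the empty word is a bijection from involutions to nonempty
elements of [B].  Once this is known, [s (y)] is the involution attached to [y],
and the Bol identity holds because [s (y) s (z) s (y)] is an involution.

Surjectivity: each [y = y_1 ... y_n] in [R] that is not a letter gives the
stabilizer element [y_1 ... y_n y] of the empty word; conjugating by these
reduces a word of [B] to a shorter one, to a palindrome, or to an element of [R].

Injectivity: if the involutions [t] and [t'] agree at [1], then [t t'] fixes the
two points [1] and [1 t].  So it is enough that a cyclically reduced word over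
[R] cannot fix two distinct points.  Repeating it gives two periodic walks with
the same labels, which never meet.  The letters of [R] of maximal length [M] on
these walks only label the edge between [1] and that letter, and the two walks
cross that edge in opposite directions; following them from there, with every
vertex of length at most [M], contradicts the definition of [D]. *)

(** * Factors, and the sets [D], [R] and [B] *)

Section Words.
Variable r : nat.
Implicit Types (a b t u v y z g : nword r) (w x : word r) (s : seq (nword r)).

Definition wlen w : nat := if w is Some t then len t else 0.

Definition size_sum s : nat := sumn (map (@len r) s).

Lemma len_gt0 t : 0 < len t.
Proof. by elim: t => //= a IHa b _; rewrite addn_gt0 IHa. Qed.

Lemma lnprod_Some t s : lnprod (Some t) s = Some (foldl (@Node r) t s).
Proof. by elim: s t => //= v s IH t; rewrite IH. Qed.

Lemma lnprod_factors t : lnprod None (factors t) = Some t.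
Proof. by elim: t => //= u IHu v _; rewrite lnprod_rcons IHu. Qed.

Lemma factors_inj : injective (@factors r).
Proof. by move=> t u e; apply: Some_inj; rewrite -!lnprod_factors e. Qed.

Lemma len_factors t : len t = size_sum (factors t).
Proof.
elim: t => [i|u IHu v _] //=.
by rewrite /size_sum map_rcons sumn_rcons IHu.
Qed.

Lemma factors_head t : exists i s, factors t = Letter i :: s.
Proof.
elim: t => [i|u [i [s IHu]] v _] /=; first by exists i, [::].
by exists i, (rcons s v); rewrite IHu.
Qed.

Lemma factors_last t : exists s z, factors t = rcons s z.
Proof.
case: t => [i|u v]; first by exists [::], (Letter i).
by exists (factors u), v.
Qed.

Lemma factors_rcons a s z : factors a = rcons s z ->
  a = z /\ s = [::] \/ exists2 b, a = Node b z & factors b = s.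
Proof.
case: a => [i|u v] /=.
  by case: s => [[->]|y s []]; [left|case: s].
by move/rcons_inj=> -[<- <-]; right; exists u.
Qed.

Lemma lnprod_rev_factors t : lnprod None (rev (factors t)) = Some (tr t).
Proof. by case: t => //= u v; rewrite rev_rcons /= lnprod_Some. Qed.

(** This is the condition under which [tr] reverses the sequence of factors: a last factor that is
    not a letter would be split by [tr] into its own factors. *)
Definition ends_letter t : bool := if t is Node _ (Node _ _) then false else true.

Lemma ends_letter_tr t : ends_letter (tr t).
Proof.
case: t => //= u v; have [i [s ->]] := factors_head u.
by rewrite rev_cons foldl_rcons.
Qed.

Lemma factors_tr t : ends_letter t -> factors (tr t) = rev (factors t).
Proof.
case: t => //= u [i _|//]; rewrite rev_rcons.
by apply/factorsP; rewrite /= lnprod_Some.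
Qed.

Lemma trK t : ends_letter t -> tr (tr t) = t.
Proof.
move=> et; apply: Some_inj; rewrite -lnprod_rev_factors factors_tr //.
by rewrite revK lnprod_factors.
Qed.

Lemma wlt_total u v : u <> v -> wlt u v = ~~ wlt v u.
Proof.
elim: u v => [i|a IHa b IHb] [j|c d] ne /=.
- by case: ltngtP => // /val_inj e; case: ne; rewrite e.
- by have := len_gt0 c; have := len_gt0 d; case: ltngtP => //; lia.
- by have := len_gt0 a; have := len_gt0 b; case: ltngtP => //; lia.
- case: ltngtP => //= _; case: (eqVneq b d) => [e|/eqP nbd].
    rewrite e /= in ne *; have nac : a <> c by move=> f; apply: ne; rewrite f.
    have I t : wlt t t = false by elim: t => /= *; rewrite ?ltnn ?eqxx /=; lia.
    by rewrite I /= IHa.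
  by rewrite /= !orbF IHb.
Qed.

Lemma wminC u v : wmin u v = wmin v u.
Proof.
rewrite /wmin; case: (eqVneq u v) => [->//|/eqP ne].
by rewrite (wlt_total ne); case: wlt.
Qed.

(** Whether [y] is [tr z] or [tr (tr z)], the other of these two words is [tr y], because [tr] is an
    involution on words that end in a letter. *)
Lemma DP y : D y ->
  [/\ W (Some y), W (Some (tr y)), ends_letter y, tr y <> y
    & wmin y (tr y) = y].
Proof.
case=> z [_ W0 W0t ne] e; rewrite e in W0 W0t ne.
have tz3 : tr (tr (tr z)) = tr z by rewrite trK ?ends_letter_tr.
have [ey|ey] : y = tr z \/ y = tr (tr z).
  by rewrite -e /y0 /wmin; case: ifP; [left|right].
- by split=> //; [rewrite ey ends_letter_tr|rewrite -{3}e /y0 ey].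
- split=> //; first by rewrite ey ends_letter_tr.
  by rewrite -{3}e /y0 ey tz3 wminC.
Qed.

Lemma D_tr y : D y -> ~ D (tr y).
Proof.
move=> /DP[_ _ et ne e] /DP[_ _ _ _]; rewrite trK // wminC e => e'.
exact: ne.
Qed.

Definition Wseq s : bool := all (fun y => `[< W (Some y) >]) s.
Definition Rseq s : bool := all (fun y => `[< R y >]) s.

Lemma Rseq_rcons s y : Rseq (rcons s y) = `[< R y >] && Rseq s.
Proof. exact: all_rcons. Qed.

Lemma Wseq_rcons s y : Wseq (rcons s y) = `[< W (Some y) >] && Wseq s.
Proof. exact: all_rcons. Qed.

Lemma RseqP s : Rseq s <-> {in s, forall y, R y}.
Proof.
split=> [/allP H y /H /asboolP //|H].
by apply/allP => y /H Ry; apply/asboolP.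
Qed.

Lemma Rseq_W s : Rseq s -> Wseq s.
Proof. by apply: sub_all => y /asboolP Ry; apply/asboolP/R_W. Qed.

Lemma R_D a v : R (Node a v) -> D (Node a v).
Proof.
case=> n _; elim: n => //= -[_ [i _]//|n IH [/IH//|[]//]].
Qed.

Lemma B_factors t : B (Some t) -> Rseq (factors t).
Proof.
elim: t => [i _|a IH v _ Bt] /=.
  by rewrite /Rseq /= andbT; apply/asboolP; exists 1 => //; exists i.
rewrite Rseq_rcons; apply/andP; split; last exact/IH/(B_left Bt).
apply/asboolP; case: Bt => // -[_ [ys [Rys]]].
case/lastP: ys Rys => // ys y Rys; rewrite lnprod_rcons.
have Ry : R y by apply: Rys; rewrite mem_rcons mem_head.
case: (lnprod None ys) => [t|] /= [].
  by move=> _ ->.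
(* The decomposition is now the single word [Node a v], which lies in [R] and hence in [D], so [v]
   is a letter. *)
move=> e; rewrite -e in Ry; have [_ _ + _ _] := DP (R_D Ry).
by case: (v) => // i _; exists 1 => //; exists i.
Qed.

Lemma R_B y : R y -> B (Some y).
Proof.
move=> Ry; right; split; first exact: R_W.
by exists [:: y]; split=> // v; rewrite inE => /eqP->.
Qed.

Lemma Rn_sub m n : m <= n -> forall y, @Rn r m y -> Rn n y.
Proof.
move=> /subnK <-; elim: (n - m) => // k IH y /IH H; rewrite addSn /=.
by case: (k + m) H => // l H; left.
Qed.

Lemma R_intro y : D y -> Rseq (factors y) -> R y.
Proof.
move=> Dy Ry.
have [n Hn] : exists n, {in factors y, forall u, Rn n u}.
  elim: (factors y) Ry => [|u s IH /= /andP[/asboolP[m _ Hm] /IH[n Hn]]].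
    by exists 0.
  exists (maxn m n) => v; rewrite inE => /predU1P[->|/Hn].
    by apply: Rn_sub Hm; rewrite leq_maxl.
  by apply: Rn_sub; rewrite leq_maxr.
(* The level must exceed [len y] and one containing all factors; the form [k.+2] selects the
   recursive clause of [Rn]. *)
pose k := maxn n (len y); exists k.+2 => //=; right; split=> //.
  by rewrite (leq_trans (leq_maxr n _)) // ltnW.
exists (factors y); split; last by rewrite lnprod_factors.
by move=> u /Hn; apply: (@Rn_sub n k.+1); rewrite ltnW // ltnS leq_maxl.
Qed.

Lemma W_factors t : W (Some t) -> Wseq (factors t).
Proof.
elim: t => [i|a IHa v _] Wt; first by rewrite /Wseq /= andbT; apply/asboolP.
have /W_Node[Wa Wv _ _] := Wt.
by rewrite /Wseq /= all_rcons; apply/andP; split; [exact/asboolP|exact: IHa].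
Qed.

Lemma sorted_neq_rcons s y z :
  sorted (fun u v => u != v) (rcons (rcons s y) z) =
  sorted (fun u v => u != v) (rcons s y) && (y != z).
Proof.
case: s => [|x s] /=; first by rewrite andbT.
by rewrite rcons_path last_rcons.
Qed.

Lemma W_sorted t : W (Some t) -> sorted (fun u v => u != v) (factors t).
Proof.
elim: t => [i|a IHa v _] //= /W_Node[Wa _ nav H].
have [s [z e]] := factors_last a; have := IHa Wa; rewrite e sorted_neq_rcons => ->.
case: (factors_rcons e) => [[<- _]|[b eb _]]; first exact/eqP.
by apply/eqP => ez; apply: (H b); rewrite eb ez.
Qed.

(** A prefix with factors [factors z] followed by [z] is the square [z z]. *)
Lemma W_no_split t z s : W (Some t) -> factors t <> factors z ++ z :: s.
Proof.
elim/last_ind: s t => [|s y IH] t Wt.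
  rewrite cats1 => /factors_rcons[[_]|[b et /factors_inj eb]].
    by have [i [l ->]] := factors_head z.
  by move: Wt; rewrite et eb => /W_Node[_ _ /(_ erefl)].
rewrite -rcons_cons -rcons_cat => /factors_rcons[[_]|[b et]].
  by case: (factors z).
by apply: IH; move: Wt; rewrite et => /W_Node[].
Qed.

(** With reduced factors and distinct neighbours only a square can obstruct: a subword [(b v) v]
    among the prefixes would have equal neighbours. *)
Lemma W_or_split t : Wseq (factors t) ->
  sorted (fun u v => u != v) (factors t) ->
  W (Some t) \/ exists z s, factors t = factors z ++ z :: s.
Proof.
elim: t => [i|a IHa v _] /=; first by move=> _ _; left; apply: W_Letter.
rewrite Wseq_rcons => /andP[/asboolP Wv Wa].
have [s [z e]] := factors_last a; rewrite e sorted_neq_rcons -e.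
move=> /andP[/(IHa Wa)[{}Wa|[y [l el]]] zv]; last first.
  by right; exists y, (rcons l v); rewrite el -rcons_cons -rcons_cat.
case: (eqVneq a v) => [->|/eqP nav].
  by right; exists v, [::]; rewrite cats1.
left; apply/W_Node; split=> // b eb.
by move: e zv; rewrite eb /= => /rcons_inj[_ ->]; rewrite eqxx.
Qed.

(** * The action on reduced words *)

Definition act w s : word r := foldl (fun w y => reduce w (Some y)) w s.

Lemma act_cat w s1 s2 : act w (s1 ++ s2) = act (act w s1) s2.
Proof. exact: foldl_cat. Qed.

Lemma act_rcons w s y : act w (rcons s y) = reduce (act w s) (Some y).
Proof. exact: foldl_rcons. Qed.

Lemma W_act w s : W w -> Wseq s -> W (act w s).
Proof.
elim: s w => //= y s IH w Ww /andP[/asboolP Wy Ws].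
by apply: IH => //; apply: reduce_W.
Qed.

Lemma B_act w s : B w -> Rseq s -> B (act w s).
Proof.
elim: s w => //= y s IH w Bw /andP[/asboolP Ry Rs].
by apply: IH => //; apply: B_reduce.
Qed.

Lemma pi_lnprod w s : W w -> Wseq s -> Defs.pi (lnprod w s) = act w s.
Proof.
move=> Ww; elim/last_ind: s => [_|s y IH]; first exact: pi_id.
rewrite Wseq_rcons => /andP[/asboolP Wy /IH e].
by rewrite lnprod_rcons pi_reduce act_rcons e (pi_id Wy).
Qed.

Lemma act_factors t : W (Some t) -> act None (factors t) = Some t.
Proof.
by move=> Wt; rewrite -pi_lnprod ?W_factors ?lnprod_factors ?pi_id //; apply: W_None.
Qed.

Variant reduce_spec w y : word r -> Prop :=
  | ReduceEq of w = Some y : reduce_spec w y None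
  | ReduceUp a of w = Some (Node a y) : reduce_spec w y (Some a)
  | ReduceDown of reduce w (Some y) = wmul w (Some y) & w <> Some y :
      reduce_spec w y (wmul w (Some y)).

Lemma reduceP w y : reduce_spec w y (reduce w (Some y)).
Proof.
have [e|/eqP ne] := eqVneq w (Some y).
  by rewrite e /reduce eqxx; constructor.
case: w ne => [[i|a b]|] ne; last by constructor.
- have -> : reduce (Some (Letter i)) (Some y) = wmul (Some (Letter i)) (Some y).
    by rewrite /reduce; case: eqP.
  by constructor=> //; rewrite /reduce; case: eqP.
- case: (eqVneq b y) => [eb|nb].
    have -> : reduce (Some (Node a b)) (Some y) = Some a.
      by rewrite /reduce; case: eqP => //; rewrite eb eqxx.
    by apply: ReduceUp; rewrite eb.
  have e : reduce (Some (Node a b)) (Some y) = wmul (Some (Node a b)) (Some y).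
    by rewrite /reduce; case: eqP => //; rewrite (negbTE nb).
  by rewrite e; constructor.
Qed.

Lemma reduce_self y : reduce (Some y) (Some y) = None.
Proof. by rewrite /reduce eqxx. Qed.

Lemma reduce_Node a y : reduce (Some (Node a y)) (Some y) = Some a.
Proof.
case: reduceP => [[/(congr1 (@len r))]|b [->] //|].
  by have := len_gt0 a; rewrite /=; lia.
by rewrite /reduce /= eqxx; case: eqP => //= _ [].
Qed.

Lemma reduceK w y : W w -> reduce (reduce w (Some y)) (Some y) = w.
Proof.
move=> Ww; case: (reduceP w y) => [->//|a e|_ _].
  move: Ww; rewrite e => Wn; exact: reduce_wmul.
by case: w Ww => [a|] _; [apply: reduce_Node|apply: reduce_self].
Qed.

Lemma reduce_neq w y : reduce w (Some y) <> w.
Proof.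
case: reduceP => [->//|a ->|_ _].
  by move=> [/(congr1 (@len r))] /=; have := len_gt0 y; lia.
case: w => //= a [/(congr1 (@len r))] /=; have := len_gt0 y; lia.
Qed.

Lemma actK w s : W w -> Wseq s -> act (act w s) (rev s) = w.
Proof.
elim: s w => //= y s IH w Ww /andP[/asboolP Wy Ws].
by rewrite rev_cons act_rcons IH ?reduceK //; apply: reduce_W.
Qed.

Lemma lnprod_len w s : wlen (lnprod w s) = wlen w + size_sum s.
Proof.
elim/last_ind: s => [|s y IH]; first by rewrite addn0.
rewrite lnprod_rcons /size_sum map_rcons sumn_rcons -/(size_sum s).
by move: IH; case: (lnprod w s) => [a|] /=; lia.
Qed.

(** Only appending keeps the total length, so a single cancellation makes the result strictly
    shorter. *)
Lemma act_len w s :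
  act w s = lnprod w s \/ wlen (act w s) < wlen w + size_sum s.
Proof.
elim/last_ind: s => [|s y IH]; first by left.
rewrite act_rcons lnprod_rcons /size_sum map_rcons sumn_rcons -/(size_sum s).
have lu : wlen (act w s) <= wlen w + size_sum s.
  by case: IH => [->|]; [rewrite lnprod_len|lia].
move: IH lu; set u := act w s => IH lu; have := len_gt0 y.
case: reduceP => [_|a eu|_ _] ly /=.
- by right; lia.
- by right; move: lu; rewrite eu /=; lia.
case: IH => [<-|IH]; first by left.
by right; move: IH; case: (u) => [a|] /=; lia.
Qed.
(** * Two walks with the same labels *)

Lemma step_noback a s z y : factors a = rcons s z -> y <> z ->
  (y = a /\ reduce (Some a) (Some y) = None) \/
  reduce (Some a) (Some y) = Some (Node a y).
Proof.
move=> ea nyz; case: reduceP => [[->]|b [eb]|_ _]; [by left| |by right].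
by move: ea; rewrite eb /= => /rcons_inj[_ /nyz].
Qed.

Section Walks.
Variable lam : nat -> nword r.
Hypothesis lam_neq : forall i, lam i <> lam i.+1.
Hypothesis lam_R : forall i, R (lam i).

Definition walk (p : nat -> word r) : Prop :=
  forall i, p i.+1 = reduce (p i) (Some (lam i)).

(** At maximal length the next step cannot append, and it cannot undo the last step since
    consecutive labels differ. So the vertex is itself the next label. *)
Lemma full_down p M i c : walk p -> (forall j, wlen (p j) <= M) ->
  p i.+1 = Some (Node c (lam i)) -> len (Node c (lam i)) = M ->
  R (Node c (lam i)).
Proof.
move=> wp lp e eM; have := lp i.+2; rewrite wp e.
have [[<- _] _ //|->] := @step_noback
  (Node c (lam i)) (factors c) (lam i) (lam i.+1) erefl (nesym (@lam_neq i)).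
by move: eM => /= <-; have := len_gt0 (lam i.+1); lia.
Qed.

Section TwoWalks.
Variables (p q : nat -> word r) (M : nat).
Hypotheses (walk_p : walk p) (walk_q : walk q).
Hypothesis len_p : forall i, wlen (p i) <= M.
Hypothesis len_q : forall i, wlen (q i) <= M.

(** Both words keep growing by the same labels, which the bound [M] forbids. The only escape is to
    jump to the empty word by reading oneself as a label; the other word then becomes longer than
    [M], since the two prefixes alone contribute [M]. Both cannot jump, as the words differ. *)
Lemma no_diverging_walks n i a b s1 s2 l z :
  p i = Some a -> q i = Some b ->
  factors a = s1 ++ rcons l z -> factors b = s2 ++ rcons l z -> s1 <> s2 ->
  M <= size_sum s1 + size_sum s2 -> lam i <> z -> M < len a + n -> False.
Proof.
elim: n i a b l z => [|n IH] i a b l z pa qb fa fb ne leM nz.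
  by have := len_p i; rewrite pa /=; lia.
have sumE s : size_sum (s ++ rcons l z) = size_sum s + size_sum l + len z.
  by rewrite /size_sum map_cat sumn_cat map_rcons sumn_rcons addnA.
move=> lan; have la := len_factors a; have lb := len_factors b.
rewrite fa sumE in la; rewrite fb sumE in lb; have lz := len_gt0 z.
have := len_p i.+1; have := len_q i.+1; move: (walk_p i) (walk_q i).
rewrite pa qb => wp wq.
have fa' := fa; have fb' := fb; rewrite -rcons_cat in fa'; rewrite -rcons_cat in fb'.
have [[ea _]|pd] := step_noback fa' nz; have [[eb _]|qd] := step_noback fb' nz.
- move=> _ _; apply: ne; have : s1 ++ rcons l z = s2 ++ rcons l z.
    by rewrite -fa -fb -ea -eb.
  move=> e; have es : size s1 = size s2.
    by move/(congr1 size): e; rewrite !size_cat; lia.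
  by move/eqP: e; rewrite eqseq_cat // => /andP[/eqP].
- by rewrite wq qd ea /=; lia.
- by rewrite wp pd eb /=; lia.
move=> _ _; apply: (IH i.+1 (Node a (lam i)) (Node b (lam i)) (rcons l z) (lam i)) => //=.
- by rewrite wp.
- by rewrite wq.
- by rewrite fa rcons_cat.
- by rewrite fb rcons_cat.
- exact/nesym.
- by have := len_gt0 (lam i); lia.
Qed.

(* [p] climbs back along the factors of [g] while [q] descends along the same
   labels, so [q] spells a prefix of [tr g].  The walks leave this pattern only
   through an edge at the empty word, or by diverging. *)
Lemma no_retracing_walks g a i b s z : D g -> len g = M ->
  p i = Some a -> q i = Some b -> factors g = factors a ++ rev (factors b) ->
  factors b = rcons s z -> lam i <> z -> False.
Proof.
move=> Dg eM; have [Wg Wt eg _ _] := DP Dg.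
elim: {a}(len a) {-2}a (leqnn (len a)) i b s z => [|n IH] a lan i b s z pa qb fg fb nz.
  by have := len_gt0 a; lia.
have := walk_p i; have := walk_q i; have := len_p i.+1; have := len_q i.+1.
rewrite pa qb.
have lM : len a + len b = M.
  by rewrite -eM !len_factors fg /size_sum map_cat sumn_cat map_rev sumn_rev.
(* Otherwise the two factors of [g] that meet at the junction would be equal. *)
have neab : factors a <> factors b.
  move=> e; have := W_sorted Wg.
  rewrite fg e fb rev_rcons sorted_cat_cons sorted_neq_rcons eqxx.
  by rewrite andbF.
have [[eb _]|qd] := step_noback fb nz.
  move=> _ _ q1; case: reduceP => [[ea]|a' [ea]|pd _] p1.
  - by apply: neab; rewrite -eb ea.
  (* Here [a] is [a' b], so the reduced word [tr g] would begin with the square [b b]. *)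
  - apply: (W_no_split Wt (z := b) (s := rev (factors a'))).
    by rewrite factors_tr // fg ea eb rev_cat revK /= rev_rcons.
  (* The word [a b] has maximal length, so it lies in [R] and [b] is a letter; then [b] is its own
     last factor [z]. *)
  - have Rab : R (Node a (lam i)).
      by apply: (full_down walk_p len_p p1); rewrite /= eb.
    have [_ _ + _ _] := DP (R_D Rab); rewrite eb /=.
    case: (factors_rcons fb) => [[ez _] _|[c ec _]]; first by apply: nz; rewrite eb.
    by rewrite ec.
move=> _ _ q1; rewrite {}qd in q1; case: reduceP => [[ea]|a' [ea]|pd _] p1.
(* Now [b a] has maximal length and lies in [R], so [a] is a letter and [b a] is [tr g], which is
   not in [D]. *)
- have Rba : R (Node b (lam i)).
    by apply: (full_down walk_q len_q q1); rewrite /= -ea -lM addnC.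
  have [_ _ + _ _] := DP (R_D Rba); rewrite -ea.
  case ka: a => [k|//] _; apply: (D_tr Dg).
  suff -> : tr g = Node b (lam i) by apply: R_D.
  by apply: factors_inj; rewrite factors_tr // fg ka rev_cat revK -ea ka /= cats1.
- apply: (IH a' _ i.+1 (Node b (lam i)) (factors b) (lam i)) => //.
  + by move: lan; rewrite ea /=; have := len_gt0 (lam i); lia.
  + by rewrite fg ea /= rev_rcons cat_rcons.
  + exact/nesym.
- apply: (@no_diverging_walks M i.+1 (Node a (lam i)) (Node b (lam i))
    (factors a) (factors b) [::] (lam i)) => //=.
  + by rewrite cats1.
  + by rewrite cats1.
  + by rewrite -!len_factors lM.
  + exact/nesym.
  + by have := len_gt0 (lam i); have := len_gt0 a; lia.
Qed.

(** While [q] enters the word [lam i], [p] can only remove the last factor of [g], a letter equal to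
    [lam i]. This starts the retracing pattern. *)
Lemma no_opposite_walks g i : R g -> len g = M -> lam i <> g ->
  p i = Some g -> q i = None -> False.
Proof.
move=> Rg eM ng pg q0; have := walk_q i; rewrite q0 /= => q1.
have := walk_p i; rewrite pg; case: reduceP => [[e]|a [eg]|_ _] p1.
- by case: ng.
- rewrite eg in Rg eM; have Dg := R_D Rg; have [_ _ + _ _] := DP Dg.
  case ev: (lam i) => [k|//] _.
  apply: (no_retracing_walks Dg eM p1 q1 (s := [::]) (z := lam i)).
  + by rewrite ev /= cats1.
  + by rewrite ev.
  + exact/nesym.
- by have := len_p i.+1; rewrite p1 /= eM; have := len_gt0 (lam i); lia.
Qed.

End TwoWalks.

Section Periodic.
Variable N : nat.
Hypothesis N_gt0 : 0 < N.

Lemma periodic_max (f : nat -> nat) : (forall i, f (i + N) = f i) ->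
  exists2 j, 0 < j & forall i, f i <= f j.
Proof.
move=> fN.
have fm i : f i = f (i %% N).
  rewrite {1}(divn_eq i N); elim: (i %/ N) => [|k IH] //.
  by rewrite mulSn -addnA addnC fN.
pose j := [arg max_(k > Ordinal N_gt0) f k].
(* Shifting by a period makes the index positive, so the maximum has a predecessor. *)
exists (j + N); first lia.
move=> i; rewrite fN fm /j; case: arg_maxnP => //= k _ H.
exact: (H (Ordinal (ltn_pmod i N_gt0))).
Qed.

Hypothesis lam_periodic : forall i, lam (i + N) = lam i.

Lemma periodic_walk p : walk p -> p N = p 0 -> forall i, p (i + N) = p i.
Proof.
by move=> wp p0; elim=> [//|i IH]; rewrite addSn !wp IH lam_periodic.
Qed.

Lemma walk_back p i : walk p -> (forall j, W (p j)) ->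
  p i = reduce (p i.+1) (Some (lam i)).
Proof. by move=> wp Wp; rewrite wp reduceK. Qed.

(* A longest vertex, if longer than every label, would be entered and left
   through the edge to its left factor, hence by the same label twice. *)
Lemma periodic_walk_len p M : walk p -> (forall i, W (p i)) ->
  p N = p 0 -> (forall i, len (lam i) <= M) -> forall i, wlen (p i) <= M.
Proof.
move=> wp Wp pN lM i.
have [j j0 jmax] := @periodic_max (fun i => wlen (p i))
  (fun i => congr1 wlen (periodic_walk wp pN i)).
rewrite (leq_trans (jmax i)) // leqNgt; apply/negP => long.
case: j j0 jmax long => // j _ jmax.
case ep: (p j.+1) => [t|] //= lt.
have up k w : w = reduce (p j.+1) (Some (lam k)) -> wlen w <= len t ->
    exists a, t = Node a (lam k).
  move=> ->; rewrite ep; case: reduceP => [[et]|a [->]|_ _] /=.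
  - by have := lM k; rewrite -et; lia.
  - by exists a.
  - by have := len_gt0 (lam k); lia.
have [] := up j.+1 (p j.+2) (wp _); first by have := jmax j.+2; rewrite ep.
have [] := up j (p j) (walk_back _ wp Wp); first by have := jmax j; rewrite ep.
by move=> a -> b [_ /lam_neq].
Qed.

(** A label of maximal length can only be read between the empty word and itself. If both walks
    cross this edge in the same direction, they meet, and reversing the steps they agree at the
    start. *)
Lemma no_two_periodic_walks p q : walk p -> walk q ->
  (forall i, W (p i)) -> (forall i, W (q i)) ->
  p N = p 0 -> q N = q 0 -> p 0 = q 0.
Proof.
move=> wp wq Wp Wq pN qN.
have [j _ jmax] := @periodic_max (fun i => len (lam i))
  (fun i => congr1 (@len r) (lam_periodic i)).
pose M := len (lam j).
have lp := periodic_walk_len wp Wp pN jmax.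
have lq := periodic_walk_len wq Wq qN jmax.
have jump f : walk f -> (forall i, wlen (f i) <= M) ->
   f j = None /\ f j.+1 = Some (lam j) \/ f j = Some (lam j) /\ f j.+1 = None.
  move=> wf lf; have := lf j; have := lf j.+1; rewrite wf.
  case: reduceP => [->|a ->|_ _]; [by right| |].
    by rewrite /= /M; have := len_gt0 a; lia.
  case: (f j) => [a|] /=; last by left.
  by rewrite /= /M; have := len_gt0 a; lia.
have back i : p i = q i -> p 0 = q 0.
  by elim: i => // i IH e; apply: IH; rewrite (walk_back i wp Wp) e -walk_back.
have nj : lam j.+1 <> lam j by apply: nesym.
case: (jump p wp lp) => -[p0 p1]; case: (jump q wq lq) => -[q0 q1].
- by apply: (back j); rewrite p0.
- by case: (no_opposite_walks wp wq lp lq (lam_R j) erefl nj p1 q1).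
- by case: (no_opposite_walks wq wp lq lp (lam_R j) erefl nj q1 p1).
- by apply: (back j); rewrite p0.
Qed.
End Periodic.
End Walks.

(** * Fixed points of reduced sequences *)

Lemma walk_act (lam : nat -> nword r) w :
  walk lam (fun i => act w (mkseq lam i)).
Proof. by move=> i; rewrite -act_rcons -mkseqS. Qed.

(** Equal first and last letters are removed by conjugation, which moves the fixed points along.
    Once they differ, the periodic repetition of the sequence labels two closed walks. *)
Lemma fixed_point_unique s w x : Rseq s -> sorted (fun u v => u != v) s ->
  s <> [::] -> W w -> W x -> act w s = w -> act x s = x -> w = x.
Proof.
have [n] := ubnP (size s); elim: n s w x => // n IH [//|y s] w x /= ssn.
move=> /andP[/asboolP Ry Rs] st _ Ww Wx fw fx.
case/lastP: s => [|s z] in ssn Rs st fw fx *; first by case: (reduce_neq fw).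
have Wy := R_W Ry; have wy := reduce_W Ww Wy; have xy := reduce_W Wx Wy.
have [ezy|/eqP nzy] := eqVneq z y.
  move: Rs st fw fx; rewrite {}ezy /Rseq all_rcons rcons_path.
  move=> /andP[_ Rs] /andP[st la]; rewrite !act_rcons => fw fx.
  have Ws := Rseq_W Rs.
  rewrite -(reduceK y Ww) -(reduceK y Wx); congr reduce.
  apply: (IH s) => //.
  - by move: ssn; rewrite size_rcons; lia.
  - exact: path_sorted st.
  - by move=> s0; move: la; rewrite s0 /= eqxx.
  - by rewrite -{2}fw reduceK //; apply: W_act.
  - by rewrite -{2}fx reduceK //; apply: W_act.
pose c := y :: rcons s z; pose N := size c; pose lam i := nth y c (i %% N).
have N0 : 0 < N by [].
have Rc : Rseq c by rewrite /Rseq /=; apply/andP; split => //; apply/asboolP.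
have /(sortedP y) stc : sorted (fun u v => u != v) c by [].
have lamN : mkseq lam N = c.
  rewrite -[RHS](mkseq_nth y); apply/eq_in_map => i.
  by rewrite mem_iota /lam => /andP[_ iN]; rewrite modn_small.
have lW k : Wseq (mkseq lam k).
  apply/allP => _ /mapP[i _ ->]; apply/(allP (Rseq_W Rc))/mem_nth.
  exact: ltn_pmod.
apply: (@no_two_periodic_walks lam _ _ N N0 _ _ _
  (walk_act lam w) (walk_act lam x)); last 2 first.
- by change (act w (mkseq lam N) = w); rewrite lamN.
- by change (act x (mkseq lam N) = x); rewrite lamN.
- move=> i; rewrite /lam; have lt := ltn_pmod i N0.
  have eS : i.+1 = i %/ N * N + (i %% N).+1 by rewrite addnS -divn_eq.
  rewrite eS modnMDl.
  have [lt1|ge1] := ltnP (i %% N).+1 N.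
    by rewrite (modn_small lt1); exact/eqP/(stc _ lt1).
  (* At the end of a period the consecutive labels are [z] and [y]. *)
  have -> : (i %% N).+1 = N by lia.
  rewrite modnn /= [i %% N](_ : _ = N.-1); last by lia.
  by rewrite /N /c nth_last /= last_rcons.
- move=> i; apply/asboolP; apply: (allP Rc); apply: mem_nth; exact: ltn_pmod.
- by move=> i; rewrite /lam modnDr.
- by move=> i; apply: W_act.
- by move=> i; apply: W_act.
Qed.

(** * Palindromes *)

(** Equal last letters cancel. If they differ, [s1] followed by the reverse of [s2] is reduced and
    fixes both [w] and [x]. *)
Lemma act_inj s1 s2 w x : Rseq s1 -> Rseq s2 ->
  sorted (fun u v => u != v) s1 -> sorted (fun u v => u != v) s2 ->
  W w -> W x -> w <> x -> act w s1 = act w s2 -> act x s1 = act x s2 -> s1 = s2.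
Proof.
move=> + + + + Ww Wx nwx.
elim/last_ind: s1 s2 => [|s1 y IH] s2 R1 R2 st1 st2 e1 e2.
  case: s2 R2 st2 e1 e2 => // z s2 R2 st2 e1 e2; case: nwx.
  exact: (fixed_point_unique R2 st2).
case/lastP: s2 => [|s2 z] in R2 st2 e1 e2 *.
  case: nwx; apply: (fixed_point_unique R1 st1) => //.
  by case: (s1).
have [eyz|nyz] := eqVneq y z; last first.
  have W1 := Rseq_W R1; have W2 := Rseq_W R2.
  case: nwx; apply: (@fixed_point_unique (rcons s1 y ++ rev (rcons s2 z))) => //.
  - rewrite /Rseq all_cat all_rev; exact/andP.
  - rewrite rev_rcons sorted_cat_cons sorted_neq_rcons st1 nyz /=.
    suff: sorted (fun u v => u != v) (rev (rcons s2 z)) by rewrite rev_rcons.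
    rewrite rev_sorted; apply: sub_sorted st2 => u v.
    by rewrite eq_sym.
  - by case: (s1).
  - by rewrite act_cat e1 actK.
  - by rewrite act_cat e2 actK.
rewrite {}eyz in R1 st1 e1 e2 *.
have /andP[/asboolP Rz R1'] := etrans (esym (Rseq_rcons s1 z)) R1.
have /andP[_ R2'] := etrans (esym (Rseq_rcons s2 z)) R2.
rewrite !act_rcons in e1 e2.
congr rcons; apply: IH => //.
- by move: st1; rewrite -cats1 => /cat_sorted2[].
- by move: st2; rewrite -cats1 => /cat_sorted2[].
- rewrite -(@reduceK (act w s1) z) ?e1 ?reduceK //.
    by apply: W_act => //; apply: Rseq_W.
  by apply: W_act => //; apply: Rseq_W.
- rewrite -(@reduceK (act x s1) z) ?e2 ?reduceK //.
    by apply: W_act => //; apply: Rseq_W.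
  by apply: W_act => //; apply: Rseq_W.
Qed.

Lemma palindrome_rcons s y : palindrome (rcons s y) = s ++ y :: rev s.
Proof. by rewrite /palindrome rev_rcons /= cat_rcons. Qed.

Lemma palindrome_cons y s : s <> [::] ->
  palindrome (y :: s) = y :: rcons (palindrome s) y.
Proof.
case/lastP: s => // s z _.
by rewrite -rcons_cons !palindrome_rcons /= rev_cons rcons_cat.
Qed.

Lemma rev_palindrome s : rev (palindrome s) = palindrome s.
Proof.
case/lastP: s => // s y.
by rewrite palindrome_rcons rev_cat rev_cons revK cat_rcons.
Qed.

Lemma palindrome_inj s1 s2 : s1 <> [::] -> s2 <> [::] ->
  palindrome s1 = palindrome s2 -> s1 = s2.
Proof.
case/lastP: s1 => // s1 y1 _; case/lastP: s2 => // s2 y2 _.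
rewrite !palindrome_rcons => e; have es : size s1 = size s2.
  by move/(congr1 size): e; rewrite !size_cat /= !size_rev; lia.
by move/eqP: e; rewrite eqseq_cat // => /andP[/eqP-> /eqP[->]].
Qed.

(** Here [s] is the left half, centre included, of a reduced odd palindrome. *)
Definition reduced_pal s : bool :=
  [&& s != [::], Rseq s & sorted (fun u v => u != v) s].

Lemma Rseq_palindrome s : Rseq s -> Rseq (palindrome s).
Proof.
case/lastP: s => // s y; rewrite palindrome_rcons /Rseq all_rcons all_cat /=.
by rewrite all_rev => /andP[-> ->].
Qed.

Lemma palindrome_sorted s : sorted (fun u v => u != v) s ->
  sorted (fun u v => u != v) (palindrome s).
Proof.
case/lastP: s => // s y st; rewrite palindrome_rcons sorted_cat_cons st /=.
suff: sorted (fun u v => u != v) (rev (rcons s y)) by rewrite rev_rcons.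
by rewrite rev_sorted; apply: sub_sorted st => u v; rewrite eq_sym.
Qed.

Lemma act_palindromeK s w : W w -> Rseq s ->
  act (act w (palindrome s)) (palindrome s) = w.
Proof.
by move=> Ww Rs; rewrite -{2}rev_palindrome actK //; apply/Rseq_W/Rseq_palindrome.
Qed.

(** The palindrome is a conjugate of its centre [y], so a fixed point of it would yield one of
    [y]. *)
Lemma act_palindrome_neq s w : W w -> reduced_pal s -> act w (palindrome s) <> w.
Proof.
case/lastP: s => // s y Ww /and3P[_ + _].
rewrite Rseq_rcons palindrome_rcons act_cat => /andP[/asboolP Ry /Rseq_W Ws] e.
have Wu := W_act Ww Ws; apply: (@reduce_neq (act w s) y).
have Wr : Wseq (rev s) by rewrite /Wseq all_rev.
have := actK (reduce_W Wu (R_W Ry)) Wr.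
by rewrite revK -[X in act X s]/(act (act w s) (y :: rev s)) e.
Qed.

(** Involutions that agree at the empty word also agree at its image, which both send back; this is
    the second point for [act_inj]. *)
Lemma reduced_pal_unique s1 s2 : reduced_pal s1 -> reduced_pal s2 ->
  act None (palindrome s1) = act None (palindrome s2) -> s1 = s2.
Proof.
move=> H1 H2 e; have /and3P[/eqP n1 R1 st1] := H1.
have /and3P[/eqP n2 R2 st2] := H2; have WN := @W_None r.
have [Rp1 Rp2] := (Rseq_palindrome R1, Rseq_palindrome R2).
apply: palindrome_inj => //; apply: (act_inj Rp1 Rp2 _ _ WN _ _ e).
- exact: palindrome_sorted.
- exact: palindrome_sorted.
- exact: W_act WN (Rseq_W Rp1).
- exact/nesym/act_palindrome_neq.
- by rewrite act_palindromeK // e act_palindromeK.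
Qed.

(** Conjugation by [y] adds an outer layer, or removes it if it is already [y]; a lone centre [y]
    stays unchanged. *)
Lemma reduced_pal_conj s y : reduced_pal s -> R y -> exists2 s', reduced_pal s' &
  forall w, W w -> act w (palindrome s') = act w (y :: rcons (palindrome s) y).
Proof.
case: s => // z s /and3P[_ Rs st] Ry; have Wy := R_W Ry.
have [ezy|nyz] := eqVneq y z; last first.
  exists (y :: z :: s); last by move=> w _; rewrite palindrome_cons.
  rewrite /reduced_pal /= nyz; apply/andP; split=> //.
  by rewrite /Rseq /=; apply/andP; split=> //; apply/asboolP.
rewrite -{}ezy in Rs st *; case: s => [|z' s] in Rs st *.
  by exists [:: y] => [|w Ww]; [apply/and3P|rewrite /= (reduceK y Ww)].
exists (z' :: s) => [|w Ww].
  by move: Rs st => /andP[_ Rs] /andP[_ st]; apply/and3P.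
rewrite (@palindrome_cons y) // -[RHS]/(act (reduce (reduce w (Some y)) (Some y)) (rcons
  (rcons (palindrome (z' :: s)) y) y)) (reduceK y Ww) !act_rcons reduceK //.
by apply: W_act => //; apply/Rseq_W/Rseq_palindrome; move: Rs => /andP[].
Qed.

Lemma reduced_pal_conj_seq s l : reduced_pal s -> Rseq l ->
  exists2 s', reduced_pal s' & forall w, W w ->
    act w (palindrome s') = act w (l ++ palindrome s ++ rev l).
Proof.
elim/last_ind: l s => [|l y IH] s Hs; first by exists s => // w _; rewrite cats0.
rewrite Rseq_rcons => /andP[/asboolP Ry Rl].
have [s1 H1 e1] := reduced_pal_conj Hs Ry; have [s2 H2 e2] := IH s1 H1 Rl.
exists s2 => // w Ww; rewrite e2 // act_cat act_cat e1.
  by rewrite -act_cat -act_cat rev_rcons -!cats1 -!catA /= -!catA.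
exact: W_act Ww (Rseq_W Rl).
Qed.

(** * Every nonempty element of [B] as the value of a palindrome *)

Definition has_pal w : Prop :=
  exists2 s, reduced_pal s & act None (palindrome s) = w.

(** Since [l] fixes the empty word, the palindrome conjugated by [l] sends it first to [w] and then
    along [rev l]. *)
Lemma has_pal_conj w l : has_pal w -> Rseq l -> act None l = None ->
  has_pal (act w (rev l)).
Proof.
move=> [s Hs es] Rl e; have [s' Hs' es'] := reduced_pal_conj_seq Hs Rl.
exists s' => //; rewrite es'; last exact: W_None.
by rewrite act_cat e act_cat es.
Qed.

Lemma has_pal_R y : R y -> has_pal (Some y).
Proof.
move=> Ry; exists [:: y] => //; apply/and3P; split=> //.
by rewrite /Rseq /= andbT; apply/asboolP.
Qed.

Lemma B_act_lt n w s t : (forall u, len u < n -> B (Some u) -> has_pal (Some u)) ->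
  B w -> Rseq s -> wlen w + size_sum s < n -> act w s = Some t -> has_pal (Some t).
Proof.
move=> IH Bw Rs ltn e; apply: IH; last by rewrite -e; apply: B_act.
have [et|] := act_len w s; last by rewrite e /=; lia.
by move: (lnprod_len w s); rewrite -et e /=; lia.
Qed.

(** At even length the two middle letters would coincide. *)
Lemma rev_fixed_palindrome s : s <> [::] -> s = rev s ->
  sorted (fun u v => u != v) s -> exists l y, s = palindrome (rcons l y).
Proof.
move=> ns es st; exists (take (size s)./2 s).
case el: (drop (size s)./2 s) => [|y l].
  by move/(congr1 size): el; rewrite size_drop /=; case: (s) ns => //= x l _; lia.
have ns2 : size s <> (size s)./2.*2.
  move=> e2; pose i := (size s)./2.-1; have s0 : 0 < size s by case: (s) ns.
  have /(sortedP y)/(_ i) := st.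
  have -> : nth y s i = nth y s i.+1.
    by rewrite {1}es nth_rev; [congr nth|]; lia.
  by rewrite eqxx => /(_ ltac:(lia)).
exists y; rewrite palindrome_rcons -[LHS](cat_take_drop (size s)./2) el.
have lh : (size s)./2 <= size s by lia.
have szl : size l = (size s)./2.
  by move/(congr1 size): el; rewrite size_drop /=; lia.
have e2 := cat_take_drop (size s)./2 s; rewrite el in e2.
have := es; rewrite -{2}e2 -[LHS]e2.
rewrite rev_cat rev_cons cat_rcons => /eqP.
rewrite eqseq_cat; last by rewrite size_rev szl size_takel.
by move=> /andP[_ /eqP[->]].
Qed.

(** If [tr t] is reduced, either it equals [t], whose factors then form a palindrome, or one of [t]
    and [tr t] lies in [R]. If not, it begins with a square [z z], and conjugation by the stabilizer
    element [rcons (factors z) z] leads to a shorter word. *)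
Lemma has_pal_ends_letter t :
  (forall u, len u < len t -> B (Some u) -> has_pal (Some u)) ->
  ends_letter t -> B (Some t) -> has_pal (Some t).
Proof.
move=> IH et Bt; have Rt := B_factors Bt; have Wt := B_W Bt.
have Rrt : Rseq (rev (factors t)) by rewrite /Rseq all_rev.
have := @W_or_split (tr t); rewrite factors_tr // => -[||Wtt|[z [s es]]].
- exact: Rseq_W.
- by rewrite rev_sorted; apply: sub_sorted (W_sorted Wt) => u v; rewrite eq_sym.
- have [ett|/eqP nt] := eqVneq (tr t) t.
    have [l [y ef]] : exists l y, factors t = palindrome (rcons l y).
      apply: rev_fixed_palindrome (W_sorted Wt); last by rewrite -factors_tr ?ett.
      by case: (t) => //= a b; case: (factors a).
    exists (rcons l y); last by rewrite -ef act_factors.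
    move: Rt (W_sorted Wt); rewrite ef palindrome_rcons -cat_rcons => Rt st.
    apply/and3P; split; first by case: (l).
      by move: Rt; rewrite /Rseq all_cat => /andP[].
    by have [] := cat_sorted2 st.
  (* If [tr t] is in [R], then [t] is its conjugate by [tr t = y_n ... y_1]. *)
  have y0t : y0 t = wmin t (tr t) by rewrite /y0 trK // wminC.
  have D0 : D (y0 t).
    exists t => //; split=> //; rewrite y0t /wmin; case: ifP => // _.
    + by rewrite trK.
    + by rewrite trK //; apply: nesym.
  move: D0; rewrite y0t /wmin; case: ifP => _ Dt.
    by apply/has_pal_R/R_intro.
  have Rtt : R (tr t) by apply: R_intro; rewrite // factors_tr.
  have := has_pal_conj (l := rcons (rev (factors t)) (tr t)) (has_pal_R Rtt).
  rewrite act_rcons -factors_tr // act_factors // reduce_self rev_rcons.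
  rewrite factors_tr // revK /= reduce_self act_factors //; apply=> //.
  by rewrite Rseq_rcons Rrt andbT; apply/asboolP.
have et2 : factors t = rev s ++ rev (rcons (factors z) z).
  by rewrite -rev_cat cat_rcons -es revK.
have /andP[Rs Rz] : Rseq (rev s) && Rseq (rcons (factors z) z).
  by move: Rt; rewrite et2 /Rseq all_cat [X in _ && X]all_rev.
have Wz : W (Some z).
  by apply: R_W; apply/asboolP; move: Rz; rewrite Rseq_rcons => /andP[].
have fz : act None (rcons (factors z) z) = None.
  by rewrite act_rcons act_factors // reduce_self.
have := act_factors Wt; rewrite et2 act_cat.
case ew: (act None (rev s)) => [t'|] e; last first.
  by move: e; rewrite -{1}fz actK //; [apply: W_None|apply: Rseq_W].
rewrite -e; apply: has_pal_conj => //; apply: B_act_lt IH (@B_None r) Rs _ ew.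
rewrite len_factors et2 /= /size_sum map_cat sumn_cat.
rewrite rev_rcons /=; have := len_gt0 z; lia.
Qed.

(** If the last factor [v] is not a letter, the stabilizer element [l] leads from
    [act (Some a) (rev (factors v))] to [a v]. The former word is shorter, or has the same length
    and ends in the first factor of [v], a letter. *)
Lemma B_has_pal t : B (Some t) -> has_pal (Some t).
Proof.
have [n] := ubnP (len t); elim: n t => // n IH t ltn Bt.
have IHt u : len u < len t -> B (Some u) -> has_pal (Some u).
  by move=> lt; apply: IH; lia.
have [et|] := boolP (ends_letter t); first exact: has_pal_ends_letter.
case: t ltn Bt IHt => // a v ltn Bt IHt nev.
have := B_factors Bt; rewrite Rseq_rcons => /andP[/asboolP Rv _].
have Ba := B_left Bt; have Wv := R_W Rv; have WN := @W_None r.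
have RBv : Rseq (factors v) by apply/B_factors/R_B.
pose l := rcons (factors v) v.
have Rl : Rseq (rev l).
  by rewrite /Rseq all_rev -/(Rseq l) Rseq_rcons RBv andbT; apply/asboolP.
have fl : act None l = None by rewrite act_rcons act_factors // reduce_self.
have frl : act None (rev l) = None.
  by rewrite -{1}fl actK //; move: (Rseq_W Rl); rewrite /Wseq all_rev.
have Rrv : Rseq (rev (factors v)) by rewrite /Rseq all_rev.
have e : act (act (Some a) (rev (factors v))) l = Some (Node a v).
  rewrite act_rcons -[X in act _ X]revK actK ?(Rseq_W Rrv) //; last exact: B_W.
  by rewrite reduce_wmul //; apply: B_W Bt.
case ew: (act (Some a) (rev (factors v))) => [t'|]; last by move: e; rewrite ew fl.
rewrite -e ew -[l]revK; apply: has_pal_conj => //.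
have := act_len (Some a) (rev (factors v)); rewrite ew => -[et'|lt].
  apply: has_pal_ends_letter; last by rewrite -ew; apply: B_act.
    move=> u lu; apply: IHt; move: (lnprod_len (Some a) (rev (factors v))).
    rewrite -et' /= /size_sum map_rev sumn_rev -/(size_sum _) -len_factors; lia.
  have [i [s ev]] := factors_head v.
  by move: et'; rewrite ev rev_cons lnprod_rcons lnprod_Some => -[->].
apply: IHt; last by rewrite -ew; apply: B_act.
by move: lt; rewrite /= /size_sum map_rev sumn_rev -/(size_sum _) -len_factors; lia.
Qed.

(** * The involution of an element and the loop identities *)

Lemma is_pal_factP w s : w <> None ->
  is_pal_fact w s <-> reduced_pal s /\ act None (palindrome s) = w.
Proof.
move=> nw; have E : Rseq s ->
    Defs.pi (lnprod None (palindrome s)) = act None (palindrome s).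
  by move=> Rs; apply/pi_lnprod/Rseq_W/Rseq_palindrome => //; apply: W_None.
split=> [[/RseqP Rs st e]|[/and3P[_ Rs st] e]].
  rewrite E // in e; split=> //; apply/and3P; split=> //.
  by apply: contra_notN nw => /eqP s0; rewrite e s0.
by split; [apply/RseqP| |rewrite E].
Qed.

Lemma is_pal_fact_exists_unique w : B w -> w <> None ->
  exists! s, is_pal_fact w s.
Proof.
case: w => // t /B_has_pal[s Hs es] nw; exists s; split; first exact/is_pal_factP.
by move=> s' /is_pal_factP[//|H e]; apply: reduced_pal_unique; rewrite // es.
Qed.

(** This is [s(w)], extended by the empty sequence at the unit so that [circ] is always the action
    of it. *)
Definition involution w : seq (nword r) :=
  if w == None then [::] else palindrome (pal_fact w).

Lemma involution_reduced_pal s : reduced_pal s ->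
  involution (act None (palindrome s)) = palindrome s.
Proof.
move=> Hs; set w := act _ _.
have nw : w <> None := act_palindrome_neq (@W_None r) Hs.
rewrite /involution (introF eqP nw) /pal_fact; congr palindrome.
case: xgetP => [s' _ /= /is_pal_factP[//|H e]|/(_ s)[]].
  exact: reduced_pal_unique.
exact/is_pal_factP.
Qed.

Lemma involutionP w : B w -> w <> None -> exists2 s, reduced_pal s &
  involution w = palindrome s /\ act None (palindrome s) = w.
Proof.
case: w => // t /B_has_pal[s Hs es] _; exists s => //; split=> //.
by rewrite -es involution_reduced_pal.
Qed.

Lemma Rseq_involution w : B w -> Rseq (involution w).
Proof.
move=> Bw; have [->//|/eqP/(involutionP Bw)[s /and3P[_ Rs _] [-> _]]] := eqVneq w None.
exact: Rseq_palindrome.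
Qed.

Lemma act_involution w : B w -> act None (involution w) = w.
Proof.
by move=> Bw; have [->//|/eqP/(involutionP Bw)[s _ [-> ->]]] := eqVneq w None.
Qed.

Lemma rev_involution w : rev (involution w) = involution w.
Proof. by rewrite /involution; case: eqP => // _; apply: rev_palindrome. Qed.

Lemma involution_R y : R y -> involution (Some y) = [:: y].
Proof.
move=> Ry; apply: (@involution_reduced_pal [:: y]); apply/and3P; split=> //.
by rewrite /Rseq /= andbT; apply/asboolP.
Qed.

Lemma circE x w : B x -> B w -> circ x w = act x (involution w).
Proof.
move=> Bx Bw; have := act_involution Bw; rewrite /circ.
have [->//|/eqP nw e] := eqVneq w None.
have [->|_] := eqVneq x None; first by rewrite e.
have := Rseq_involution Bw; rewrite /involution (introF eqP nw) => /Rseq_W Wp.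
by rewrite pi_lnprod //; apply: B_W.
Qed.

Lemma circxx x : B x -> circ x x = None.
Proof.
move=> Bx; rewrite circE // -{1}(act_involution Bx) -{2}rev_involution.
by rewrite actK; [|apply: W_None|apply/Rseq_W/Rseq_involution].
Qed.

Lemma circ1w w : circ None w = w.
Proof. by rewrite /circ; case: eqP. Qed.

Lemma circw1 w : circ w None = w.
Proof. by rewrite /circ eqxx. Qed.

(** The conjugate [s(w1) s(w2) s(w1)] is an involution with value [(w1 w2) w1] at the empty word. By
    uniqueness it is the involution of that element, and both sides are its action on [x]. *)
Lemma circ_bol x w1 w2 : B x -> B w1 -> B w2 ->
  circ x (circ (circ w1 w2) w1) = circ (circ (circ x w1) w2) w1.
Proof.
move=> Bx B1 B2; have B12 := B_circ B1 B2; have Bx1 := B_circ Bx B1.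
(* For trivial [w2] the conjugate is the identity and not an involution. *)
have [e2|n2] := pselect (w2 = None).
  rewrite e2 !circw1 circxx // circw1 (circE Bx B1) circE //; last first.
    by apply: B_act; rewrite ?Rseq_involution.
  by rewrite -{2}rev_involution actK //; [exact: B_W|exact/Rseq_W/Rseq_involution].
have [s Hs [es _]] := involutionP B2 n2.
have [s' Hs' es'] := reduced_pal_conj_seq Hs (Rseq_involution B1).
have E w : B w -> circ (circ (circ w w1) w2) w1 = act w (palindrome s').
  move=> Bw; have Bw1 := B_circ Bw B1; have Bw2 := B_circ Bw1 B2.
  rewrite es' ?rev_involution -?es; last exact: B_W.
  by rewrite (circE Bw2 B1) (circE Bw1 B2) (circE Bw B1) act_cat act_cat.
have := E None (@B_None r); rewrite circ1w => e.
rewrite E // circE //; last exact: B_circ.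
by rewrite e involution_reduced_pal.
Qed.

End Words.

(** * Bol loops of exponent two *)

(** This is the Bol identity with the unit as middle element. *)
Lemma bol_cancel (L : Type) (mul : L -> L -> L) (e : L) :
  right_id e mul -> right_bol mul -> (forall x, mul x x = e) ->
  forall x y, mul (mul x y) y = x.
Proof. by move=> m1 bol sq x y; have := bol x y e; rewrite !m1 sq m1. Qed.

(* The solution of [a x = b] is [(a (b a)) a]. *)
Lemma bol_loop2_intro (L : Type) (mul : L -> L -> L) (e : L) :
  left_id e mul -> right_id e mul -> right_bol mul -> (forall x, mul x x = e) ->
  is_bol_loop2 mul e.
Proof.
move=> m1l m1r bol sq; have K := bol_cancel m1r bol sq.
split=> //; split=> // a b.
- exists (mul (mul a (mul b a)) a); split=> [|x <-]; first by rewrite bol sq m1l K.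
  by rewrite bol sq m1l K.
- by exists (mul b a); split=> [|x <-]; rewrite K.
Qed.

(** * Evaluation of words in a Bol loop of exponent two *)

Section Evaluation.
Variables (r : nat) (L : Type) (mul : L -> L -> L) (e : L) (f : 'I_r -> L).
Hypotheses (mul1x : left_id e mul) (mulx1 : right_id e mul).
Hypotheses (bol : right_bol mul) (mulxx : forall x, mul x x = e).

Fixpoint neval (t : nword r) : L :=
  match t with
  | Letter i => f i
  | Node u v => mul (neval u) (neval v)
  end.

Definition eval (w : word r) : L := if w is Some t then neval t else e.

Lemma eval_reduce w y : eval (reduce w (Some y)) = mul (eval w) (neval y).
Proof.
case: reduceP => [->|a ->|_ _] /=; first by rewrite mulxx.
  by rewrite (bol_cancel mulx1).
by case: w.
Qed.

Lemma eval_act w s : eval (act w s) = foldl mul (eval w) (map neval s).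
Proof. by elim: s w => //= y s IH w; rewrite IH eval_reduce. Qed.

(** The Bol identity absorbs one layer of the palindrome at a time, so the composite of the right
    translations is a single right translation. *)
Lemma foldl_palindrome x (s : seq (nword r)) :
  foldl mul x (map neval (palindrome s)) =
  mul x (foldl mul e (map neval (palindrome s))).
Proof.
elim: s x => [|y s IH] x; first by rewrite mulx1.
case: s IH => [|z s] IH; first by rewrite /= mul1x.
rewrite palindrome_cons //; move: (palindrome _) IH => p IH.
by rewrite /= map_rcons !foldl_rcons IH [in RHS]IH mul1x bol.
Qed.

Lemma eval_circ w x : B w -> B x -> eval (circ w x) = mul (eval w) (eval x).
Proof.
move=> Bw Bx; rewrite circE // eval_act -{2}(act_involution Bx) eval_act.
by rewrite /involution; case: eqP => [_|_]; [rewrite mulx1|apply: foldl_palindrome].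
Qed.

End Evaluation.

(** * Freeness of the loop on [B] *)

Lemma BX_B r (w : BX r) : B (val w).
Proof. exact: set_mem (valP w). Qed.

Lemma BX_bol_loop2 r : is_bol_loop2 (@BXmul r) BXone.
Proof.
apply: bol_loop2_intro => [w|w|w1 w2 w3|w]; apply: val_inj => /=.
- exact: circ1w.
- exact: circw1.
- by apply: circ_bol; apply: BX_B.
- by apply: circxx; apply: BX_B.
Qed.

Lemma BX_generated r : generates (@BXmul r) BXone (range (@BXgen r)).
Proof.
move=> S [S1 SM _ _] SX.
pose S' (w : word r) := forall Bw : w \in @B r, S (exist _ w Bw).
have S'mul w x : B w -> B x -> S' w -> S' x -> S' (circ w x).
  move=> Bw Bx Sw Sx Bwx.
  have := SM _ _ (Sw (mem_set Bw)) (Sx (mem_set Bx)).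
  by congr S; apply: val_inj.
have S'N : S' None by move=> B1; move: S1; congr S; apply: val_inj.
have S'L i : S' (Some (Letter i)).
  by move=> Bi; have := SX (BXgen i) (ex_intro2 _ _ i I erefl); congr S; apply: val_inj.
have S'B t : B (Some t) -> S' (Some t).
  elim: t => [i _|a IHa v IHv Bt]; first exact: S'L.
  have := B_factors Bt; rewrite Rseq_rcons => /andP[/asboolP Rv _].
  have Ba := B_left Bt; have Bv := R_B Rv.
  (* As [v] lies in [R], its involution is [[:: v]], so the last factor splits off as a loop
     factor. *)
  have -> : Some (Node a v) = circ (Some a) (Some v).
    by rewrite circE // involution_R //= reduce_wmul //; apply: B_W.
  by apply: S'mul => //; [apply: IHa|apply: IHv].
apply/seteqP; split=> // -[[t|] Bt] _; last exact: S'N.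
exact/S'B/set_mem.
Qed.

Theorem theorem5p2 (r : nat) :
  (forall g : word r, B g -> g <> None -> exists! gs, is_pal_fact g gs) /\
  free_bol_loop2 (@BXmul r) (@BXone r) (@BXgen r).
Proof.
split; first exact: is_pal_fact_exists_unique.
split.
- exact: BX_bol_loop2.
- by move=> i j [].
- exact: BX_generated.
- move=> L mul e [[m1x mx1 _ _] bol sq] f.
  exists (fun w => eval mul e f (val w)); split=> // w x /=.
  by apply: eval_circ => //; apply: BX_B.
Qed.
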